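(* Let $(P,\omega)$ be a canonically labeled sign-graded poset of rank $r$ with $p=|P|$, and write $W(P,\omega;t)=\sum_{i=0}^{\lfloor d/2\rfloor}a_i(P,\omega)t^i(1+t)^{d-2i}$ with $d=p-r-1$. If $r=0$ then $$W(P,\omega;t)=2^{-p+1}(1+t)^{p-1}\,\overline{W}\big(P,\omega;4t(1+t)^{-2}\big),$$ equivalently $a_i(P,\omega)=2^{-p+1+2i}\,|\{\pi\in\mathcal{L}(P,\omega):\operatorname{peak}(\pi)=i\}|$. If $r=1$ then $$W(P,\omega;t)=2^{-p}t^{-1}(1+t)^{p}\,\overline{W}\big(\hat P,\hat\omega;4t(1+t)^{-2}\big),$$ equivalently $a_i(P,\omega)=2^{-p+2+2i}\,|\{\pi\in\mathcal{L}(\hat P,\hat\omega):\operatorname{peak}(\pi)=i+1\}|$, where $\hat P$ is $P$ with a greatest element adjoined and $\hat\omega$ is any canonical labeling of $\hat P$.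
   Context: A labeled poset is a finite poset $P$ with an injection $\omega:P\to\mathbb{Z}$. Its Jordan–Hölder set $\mathcal{L}(P,\omega)$ is the set of words $\pi=a_1\cdots a_p$ that are permutations of $\omega(P)$ such that $x<_Py$ implies $\omega(x)$ precedes $\omega(y)$. For a cover relation $x\lessdot y$ let $\epsilon(x,y)=1$ if $\omega(x)<\omega(y)$ and $-1$ otherwise. $(P,\omega)$ is sign-graded if for every maximal chain $x_1<\cdots<x_k$ the sum $\sum_{i=2}^k\epsilon(x_{i-1},x_i)$ is the same; this value $r$ is the rank, and $\rho(x)$ is the analogous sum along any saturated chain from a minimal element to $x$. A labeling is canonical if the labeled poset is sign-graded, $\rho$ takes values in $\{0,1\}$, rank-$0$ elements have negative labels and rank-$1$ elements positive labels. For $\pi=a_1\cdots a_p$: $\operatorname{des}(\pi)=|\{i\in[p-1]:a_i>a_{i+1}\}|$, $\operatorname{peak}(\pi)=|\{2\le i\le p-1:a_{i-1}<a_i>a_{i+1}\}|$. $W(P,\omega;t)=\sum_{\pi\in\mathcal{L}(P,\omega)}t^{\operatorname{des}(\pi)}$ and $\overline{W}(P,\omega;t)=\sum_{\pi\in\mathcal{L}(P,\omega)}t^{\operatorname{peak}(\pi)}$. *)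

(* Defs.v *)
From mathcomp Require Import all_boot all_order all_algebra.
Set Implicit Arguments. Unset Strict Implicit. Unset Printing Implicit Defensive.
Import Order.TTheory GRing.Theory Num.Theory.

(* A labeled poset: a finite type T, a relation [le] (the order <=_P) that is a
   partial order, and a labeling [om : T -> int] that is injective. *)

Section LabeledPoset.
Variables (T : finType) (le : rel T) (om : T -> int).

Definition is_poset : Prop :=
  [/\ reflexive le, antisymmetric le & transitive le].

Definition ltP (x y : T) : bool := (x != y) && le x y.

Definition coverP (x y : T) : bool :=
  ltP x y && [forall z, ~~ (ltP x z && ltP z y)].

Definition minimalP (x : T) : bool := [forall z, ~~ ltP z x].

Definition eps (x y : T) : int := if (om x < om y)%R then 1%R else (-1)%R.

Definition chain_sum (s : seq T) : int :=
  (\sum_(e <- zip s (behead s)) eps e.1 e.2)%R.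

Definition max_chain (s : seq T) : Prop :=
  sorted ltP s /\
  forall x, x \notin s -> ~ (all (fun y => le x y || le y x) s).

Definition sign_graded_rank (r : int) : Prop :=
  forall s, max_chain s -> chain_sum s = r.

Definition rho_is (x : T) (k : int) : Prop :=
  forall (x0 : T) (s : seq T), minimalP x0 -> path coverP x0 s -> last x0 s = x ->
    chain_sum (x0 :: s) = k.

Definition sign_graded : Prop := exists r, sign_graded_rank r.

Definition canonical_labeling : Prop :=
  [/\ sign_graded,
      forall x, rho_is x 0 \/ rho_is x 1,
      forall x, rho_is x 0 -> (om x < 0)%R &
      forall x, rho_is x 1 -> (0 < om x)%R].

(* Jordan-Hoelder set: permutations of omega(P) such that x <_P y implies
   omega(x) precedes omega(y). Given as a duplicate-free list. *)
Definition linext (w : seq int) : bool :=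
  [forall x, forall y, ltP x y ==> (index (om x) w < index (om y) w)].

Definition JH : seq (seq int) :=
  [seq w <- permutations (map om (enum T)) | linext w].

End LabeledPoset.

Definition des (w : seq int) : nat :=
  count (fun i => (nth 0 w i > nth 0 w i.+1)%R) (iota 0 (size w).-1).

(* peaks at positions 2 <= i <= p-1 (1-indexed), i.e. 1 <= i <= p-2 (0-indexed) *)
Definition peak (w : seq int) : nat :=
  count (fun i => (nth 0 w i.-1 < nth 0 w i)%R && (nth 0 w i > nth 0 w i.+1)%R)
        (iota 1 (size w).-2).

Definition Wdes (R : ringType) (T : finType) (le : rel T) (om : T -> int) (t : R) : R :=
  (\sum_(w <- JH le om) t ^+ des w)%R.

Definition Wpeak (R : ringType) (T : finType) (le : rel T) (om : T -> int) (t : R) : R :=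
  (\sum_(w <- JH le om) t ^+ peak w)%R.

Definition hat_le (T : finType) (le : rel T) : rel (option T) :=
  fun x y => match x, y with
             | _, None => true
             | None, Some _ => false
             | Some a, Some b => le a b
             end.

(* Main.v *)
Require Import Defs.
From mathcomp Require Import all_boot all_order all_algebra.
From mathcomp Require Import fingroup perm.
From mathcomp Require Import zify ring lra.
Import Order.TTheory GRing.Theory Num.Theory.
Local Open Scope ring_scope.

(** Signs alternate along the covers of a canonically labeled poset, so that
    consecutive letters of equal sign in a word of the Jordan-Hölder set are
    pairwise incomparable and may be permuted freely. Border the words by 0. The
    Foata-Strehl move L A x B S -> L B x A S, where A and B are the maximal runs
    of letters next to x that are further from 0 than x on the same side, then
    preserves the Jordan-Hölder set, exchanges the double ascents and double
    descents at x, and leaves the type of every other letter unchanged. In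
    t^des a peak or double descent weighs t and a valley or double ascent weighs
    1; averaging over the moves gives every double ascent and double descent the
    weight (1 + t) / 2, and since there is one more valley than peaks (rank 0),
    the result is the peak polynomial. For rank 1, adjoining the top element
    multiplies the descent polynomial by t, once one knows that the latter depends
    only on the signs of the labels; this follows by transposing labels of
    consecutive values. *)

(** * Descents, peaks and the Foata-Strehl move *)

Lemma des_cons (a b : int) s : des [:: a, b & s] = ((b < a)%R + des (b :: s))%N.
Proof.
rewrite /des /= -[1%N]/(1 + 0)%N iotaDl count_map; congr (_ + _)%N.
Qed.

Lemma des_rcons (a : int) s c :
  des (rcons (a :: s) c) = (des (a :: s) + (c < last a s)%R)%N.
Proof.
elim: s a => [|b s IH] a //; first by rewrite /= des_cons [des [:: _]]/= addnC.
by rewrite !rcons_cons des_cons -rcons_cons IH des_cons addnA.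
Qed.

Lemma peak_cons (a b c : int) s :
  peak [:: a, b, c & s]
    = (((a < b)%R && (c < b)%R) + peak [:: b, c & s])%N.
Proof.
rewrite /peak /= -[2%N]/(1 + 1)%N iotaDl count_map; congr (_ + _)%N.
by apply: eq_in_count => -[|k] //; rewrite mem_iota.
Qed.

Lemma peak_cons_desc (a b : int) s : (b < a)%R -> peak [:: a, b & s] = peak (b :: s).
Proof.
case: s => [|c s] ba //; rewrite peak_cons ltNge.
by rewrite (ltW ba).
Qed.

(** Peaks are never adjacent: if the second letter is a peak, the third is not, and the induction
    drops two letters. *)
Lemma peak_bound w : (2 * peak w <= (size w).-1)%N.
Proof.
have [n] := ubnP (size w); elim: n w => // n IH [|a [|b [|c s]]] // lt_n.
rewrite peak_cons.
have := IH [:: b, c & s] lt_n.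
case: (ltP c b) => [cb|_]; last by rewrite andbF /=; lia.
rewrite peak_cons_desc //= andbT => IH1.
have := IH (c :: s); rewrite /= in lt_n * => /(_ ltac:(lia)).
by case: (a < b)%R; lia.
Qed.

Section Weights.
Variable R : comNzRingType.
Implicit Types (g : int -> bool -> bool -> R) (w : seq int) (l r x : int).

(* The product over the letters y of w of g y (previous < y) (y < next), the
   word being bordered by l and r. *)
Fixpoint wt g l w r : R :=
  if w is y :: w' then g y (l < y) (y < head r w') * wt g y w' r else 1.

Lemma wt_cat g l w1 w2 r :
  wt g l (w1 ++ w2) r = wt g l w1 (head r w2) * wt g (last l w1) w2 r.
Proof.
elim: w1 l => [|y w1 IH] l /=; first by rewrite mul1r.
by rewrite IH mulrA; case: w1 {IH}.
Qed.

Lemma wt_border g l l' w r r' :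
    (w <> [::] -> (l < head 0 w) = (l' < head 0 w)) ->
    (w <> [::] -> (last 0 w < r) = (last 0 w < r')) ->
  wt g l w r = wt g l' w r'.
Proof.
elim: w l l' => [|y w IH] l l' //= hl hr.
rewrite hl //; case: w IH hr {hl} => [|z w] IH hr /=; first by rewrite hr.
by congr (_ * _); apply: IH => // _; apply: hr.
Qed.

Lemma eq_wt g g' l w r :
  {in w, forall y b c, g y b c = g' y b c} -> wt g l w r = wt g' l w r.
Proof.
elim: w l => //= y w IH l E; rewrite E ?mem_head // IH // => z zw.
by apply: E; rewrite inE zw orbT.
Qed.

(** Letters beyond a nonzero [x] have its sign, so the move built on this relation permutes letters
    of one sign only. *)
Definition beyond x : pred int := fun y => if 0 < x then x < y else y < x.

(** [L] is the part before [x] read backwards, so that [find] measures both runs outward from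
    [x]. *)
Definition hop x w :=
  let L := rev (take (index x w) w) in let S := drop (index x w).+1 w in
  let j := find (predC (beyond x)) L in let k := find (predC (beyond x)) S in
  rev (drop j L) ++ take k S ++ x :: rev (take j L) ++ drop k S.

(** The last two conditions make the runs [A] and [B] maximal; the default 0 covers an empty [L] or
    [S], as 0 is never beyond [x]. Indexing by both words lets a case analysis rewrite a word and
    its image together. *)
Variant hop_split x : seq int -> seq int -> Prop :=
  HopSplit L A B S of
    all (beyond x) A & all (beyond x) B
    & ~~ beyond x (last 0 L) & ~~ beyond x (head 0 S)
  : hop_split x (L ++ A ++ x :: B ++ S) (L ++ B ++ x :: A ++ S).

Lemma beyond0 x : ~~ beyond x 0.
Proof. by rewrite /beyond; case: ifP; lia. Qed.

Lemma find_beyond x A S : all (beyond x) A -> ~~ beyond x (head 0 S) ->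
  find (predC (beyond x)) (A ++ S) = size A.
Proof.
move=> allA hS; rewrite find_cat has_predC allA /=.
by case: S hS => [|c S] /= hc; rewrite ?hc addn0.
Qed.

Lemma hopE x L A B S :
    uniq (L ++ A ++ x :: B ++ S) ->
    all (beyond x) A -> all (beyond x) B ->
    ~~ beyond x (last 0 L) -> ~~ beyond x (head 0 S) ->
  hop x (L ++ A ++ x :: B ++ S) = L ++ B ++ x :: A ++ S.
Proof.
rewrite catA => U aA aB hL hS.
have xNLA : x \notin L ++ A.
  by move: U; rewrite cat_uniq => /and3P[_ /norP[/= ]].
have iE : index x ((L ++ A) ++ x :: B ++ S) = size (L ++ A).
  by rewrite index_cat (negbTE xNLA) /= eqxx addn0.
rewrite /hop iE take_size_cat // drop_cat ltnNge leqnSn /= subSnn /= drop0.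
rewrite rev_cat find_beyond // ?find_beyond ?all_rev //; last first.
  by case/lastP: L hL {U iE xNLA} => // L a; rewrite last_rcons rev_rcons.
rewrite !size_rev.
by rewrite !take_size_cat ?size_rev // !drop_size_cat ?size_rev // !revK.
Qed.

Lemma hopP x w : uniq w -> x \in w -> hop_split x w (hop x w).
Proof.
move=> Uw xw; case/splitPr: xw Uw => L S Uw.
pose j := find (predC (beyond x)) (rev L).
pose k := find (predC (beyond x)) S.
have pre s : all (beyond x) (take (find (predC (beyond x)) s) s).
  by elim: s => //= a s IH; case: (boolP (beyond x a)) => //= ->.
have suf s : ~~ beyond x (head 0 (drop (find (predC (beyond x)) s) s)).
  elim: s => [|a s IH] /=; first exact: beyond0.
  by case: (boolP (beyond x a)) => /=.
have LE : L = rev (drop j (rev L)) ++ rev (take j (rev L)).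
  by rewrite -rev_cat cat_take_drop revK.
have SE : S = take k S ++ drop k S by rewrite cat_take_drop.
have aA : all (beyond x) (rev (take j (rev L))) by rewrite all_rev pre.
have hL : ~~ beyond x (last 0 (rev (drop j (rev L)))).
  have := suf (rev L); rewrite -/j; case: (drop j _) => //= a s.
  by rewrite rev_cons last_rcons.
have hS := suf S; have aB := pre S; rewrite -/k in hS aB.
move: (rev (drop _ _)) (rev (take _ _)) LE aA hL => L' A LE aA hL.
move: (take k S) (drop k S) SE aB hS => B S' SE aB hS.
rewrite {}SE {}LE -catA in Uw *.
by rewrite hopE //; split.
Qed.

(** Swapping and negating the two comparisons exchanges double ascents with double descents at [x]
    and fixes peaks and valleys. *)
Definition flip x g : int -> bool -> bool -> R :=
  fun y b c => if y == x then g y (~~ c) (~~ b) else g y b c.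

(** The letters [a] and [c] that enclose the block [A x B] compare with every letter of it as they
    do with [x], so rearranging the block leaves their types alone. *)
Lemma wt_hop x w g : uniq w -> x \in w -> x != 0 ->
  wt g 0 (hop x w) 0 = wt (flip x g) 0 w 0.
Proof.
move=> Uw xw x0; case: hopP (Uw) => // L A B S aA aB hL hS {xw w} {}Uw.
have xN : [/\ x \notin L, x \notin A, x \notin B & x \notin S].
  move: Uw; rewrite !cat_uniq /= !cat_uniq !has_cat /= !mem_cat !negb_or.
  move=> /and3P[_ /and3P[_ -> _]] /and3P[_ /andP[-> _]].
  by move=> /andP[/andP[-> ->]].
case: xN => xL xA xB xS.
rewrite !wt_cat /= !wt_cat /=.
have nx g' s l r : x \notin s -> wt (flip x g') l s r = wt g' l s r.
  move=> xs; apply: eq_wt => y ys b c; rewrite /flip.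
  by case: eqP => // yx; rewrite -yx ys in xs.
rewrite !nx // {1}/flip eqxx.
set a := last 0 L in hL *; set c := head 0 S in hS *.
have ax : a != x.
  rewrite /a; case: (L) xL => [|z s]; first by rewrite eq_sym.
  by apply: contraNneq => /= <-; exact: mem_last.
have cx : c != x.
  rewrite /c; case: (S) xS => [|z s] /=; first by rewrite eq_sym.
  by apply: contraNneq => <-; exact: mem_head.
have hdP s d : all (beyond x) s ->
    s <> [::] -> beyond x (head d s) by case: s => //= z s /andP[].
have lsP s d : all (beyond x) s -> s <> [::] -> beyond x (last d s).
  by move=> /allP h; case: s h => // z s h _ /=; apply/h/mem_last.
have far v v' : (v = x) \/ beyond x v -> (v' = x) \/ beyond x v' ->
    ((a < v) = (a < v')) * ((v < c) = (v' < c)).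
  move: hL hS ax cx x0; rewrite /beyond; case: ifP => *; split; lia.
(* For a letter beyond [x], replacing the neighbour [x] by [a] or [c] changes no comparison, so a
   run keeps its types on either side of [x]. *)
have near v : beyond x v ->
    ((a < v) = (x < v)) * ((v < x) = (v < c)).
  move: hL hS ax cx x0; rewrite /beyond; case: ifP => *; split; lia.
have hd s s' : all (beyond x) s ->
    let v := head 0 (s ++ x :: s') in v = x \/ beyond x v.
  by case: s => [|z s] /=; [left | case/andP; right].
have ls s : all (beyond x) s -> let v := last x s in v = x \/ beyond x v.
  by case: s => [|z s] h; [left | right; apply: lsP].
have -> : wt g 0 L (head 0 (B ++ x :: A ++ S)) = wt g 0 L (head 0 (A ++ x :: B ++ S)).
  by apply: wt_border => // _; case: (far _ _ (hd B (A ++ S) aB) (hd A (B ++ S) aA)).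
have mid s : all (beyond x) s -> wt g a s x = wt g x s c.
  by move=> h; apply: wt_border => ns;
    [case: (near _ (hdP s 0 h ns)) | case: (near _ (lsP s 0 h ns))].
rewrite (mid A) // (mid B) //.
have -> : wt g (last x A) S 0 = wt g (last x B) S 0.
  by apply: wt_border => // _; case: (far _ _ (ls A aA) (ls B aB)).
(* Both ends of a nonempty [B] lie on one side of [x], and so do [a] and [c] if [B] is empty; hence
   the comparison on the left of [x] after the move negates the one on its right before. *)
have -> : (last a B < x) = ~~ (x < head 0 (B ++ S)).
  case: (B) aB => [|z s] aBs /=.
    by rewrite -/c; move: hL hS ax cx x0; rewrite /beyond; case: ifP => *; lia.
  have := hdP _ 0 aBs; have := lsP _ 0 aBs; rewrite /= /beyond.
  by case: ifP => _ /(_ ltac:(by [])) ? /(_ ltac:(by [])) ?; lia.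
have -> : (x < head 0 (A ++ S)) = ~~ (last a A < x).
  case: (A) aA => [|z s] aAs /=.
    by rewrite -/c; move: hL hS ax cx x0; rewrite /beyond; case: ifP => *; lia.
  have := hdP _ 0 aAs; have := lsP _ 0 aAs; rewrite /= /beyond.
  by case: ifP => _ /(_ ltac:(by [])) ? /(_ ltac:(by [])) ?; lia.
ring.
Qed.
End Weights.

Lemma perm_hop x w : uniq w -> x \in w -> perm_eq (hop x w) w.
Proof.
move=> Uw xw; case: hopP => // L A B S *.
by apply/seq.permP => p; rewrite !count_cat /= !count_cat; lia.
Qed.

Lemma hopK x w : uniq w -> x \in w -> hop x (hop x w) = w.
Proof.
move=> Uw xw; have := Uw; rewrite -(perm_uniq (perm_hop x w Uw xw)).
by case: hopP => // L A B S *; rewrite hopE.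
Qed.

Lemma big_involutive (V : nmodType) (I : eqType) (s : seq I) (h : I -> I) (F : I -> V) :
    uniq s -> {in s, forall i, h i \in s} -> {in s, cancel h h} ->
  \sum_(i <- s) F (h i) = \sum_(i <- s) F i.
Proof.
move=> Us hs hK; rewrite -(big_map h predT F); apply: perm_big.
apply: uniq_perm => // [|i].
  by rewrite map_inj_in_uniq // => i j si sj /(congr1 h); rewrite !hK.
apply/mapP/idP => [[j sj ->]|si]; first exact: hs.
by exists (h i); [exact: hs | rewrite hK].
Qed.

(** * Averaging the weights over the moves *)

Section Averaging.
Variables (R : realFieldType) (t : R).

Definition des_wt (y : int) (b c : bool) : R := if c then 1 else t.
Definition peak_wt (y : int) (b c : bool) : R :=
  if b == c then (1 + t) / 2 else des_wt y b c.
(** Interpolates between the two weights: the letters of [X] are those already averaged. *)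
Definition mixed_wt (X : seq int) (y : int) : bool -> bool -> R :=
  if y \in X then peak_wt y else des_wt y.

(** A letter of a duplicate-free word contributes a single factor, so the product is linear in the
    weight of [x]. *)
Lemma wt_average x w (g1 g2 g3 : int -> bool -> bool -> R) l r :
    uniq w -> x \in w ->
    (forall y b c, y != x -> g1 y b c = g3 y b c) ->
    (forall y b c, y != x -> g2 y b c = g3 y b c) ->
    (forall b c, g3 x b c = (g1 x b c + g2 x b c) / 2) ->
  wt R g3 l w r = (wt R g1 l w r + wt R g2 l w r) / 2.
Proof.
move=> Uw xw E1 E2 E3; case/splitPr: xw Uw => L S Uw.
have [xL xS] : x \notin L /\ x \notin S.
  by move: Uw; rewrite cat_uniq /= => /and3P[_ /norP[-> _] /andP[-> _]].
have off s g l' r' : x \notin s -> (forall y b c, y != x -> g y b c = g3 y b c) ->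
    wt R g l' s r' = wt R g3 l' s r'.
  move=> xs E; apply: eq_wt => y ys b c; apply: E.
  by apply: contraNneq xs => <-.
rewrite !wt_cat /= E3 !(off _ g1) // !(off _ g2) //.
by field.
Qed.

(* Hopping x swaps its double ascents with its double descents and changes
   nothing else, so on average both carry the weight (1 + t) / 2. *)
Lemma sum_mixed_wt (J : seq (seq int)) (X : seq int) :
    uniq J -> uniq X -> 0 \notin X ->
    {in J, forall w, uniq w} -> {in J, forall w, {subset X <= w}} ->
    {in X & J, forall x w, hop x w \in J} ->
  \sum_(w <- J) wt R des_wt 0 w 0 = \sum_(w <- J) wt R (mixed_wt X) 0 w 0.
Proof.
move=> UJ + + Uw; elim: X => [|x X IH] //= /andP[xX UX] X0 Xw XJ.
have xw w : w \in J -> x \in w by move/Xw; apply; exact: mem_head.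
have x0 : x != 0 by move: X0; rewrite inE negb_or eq_sym => /andP[].
rewrite IH //; first last.
- by move=> y w yX wJ; apply: XJ => //; rewrite inE yX orbT.
- by move=> w wJ y yX; apply: (Xw w wJ); rewrite inE yX orbT.
- by move: X0; rewrite inE negb_or => /andP[].
have flipE : \sum_(w <- J) wt R (mixed_wt X) 0 w 0
    = \sum_(w <- J) wt R (flip R x (mixed_wt X)) 0 w 0.
  rewrite -(big_involutive _ _ J (hop x)) //.
  - by apply: eq_big_seq => w wJ; rewrite wt_hop ?xw ?Uw.
  - by move=> w wJ; apply: XJ => //; exact: mem_head.
  - by move=> w wJ; rewrite hopK ?xw ?Uw.
have -> : \sum_(w <- J) wt R (mixed_wt X) 0 w 0
    = (\sum_(w <- J) wt R (mixed_wt X) 0 w 0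
       + \sum_(w <- J) wt R (flip R x (mixed_wt X)) 0 w 0) / 2.
  by rewrite -flipE; field.
rewrite -big_split mulr_suml; apply: eq_big_seq => w wJ /=.
apply/esym/(wt_average x) => [||y b c|y b c|b c]; rewrite ?xw ?Uw //.
- by rewrite /mixed_wt inE => /negbTE->.
- by rewrite /flip /mixed_wt inE => /negbTE->.
rewrite /flip /mixed_wt !inE eqxx /= (negbTE xX) /peak_wt /des_wt.
by case: b c => [] [] /=; field.
Qed.

(** The last letter is negative, so the final border 0 creates no descent. *)
Lemma wt_des l w : uniq w -> last 0 w < 0 -> wt R des_wt l w 0 = t ^+ des w.
Proof.
elim: w l => [|y [|z w] IH] l //= U h; first by rewrite /des_wt h mulr1.
case/andP: U => yz U; rewrite des_cons exprD -(IH y) //; congr (_ * _).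
have: y != z by apply: contraNneq yz => ->; exact: mem_head.
by rewrite /des_wt; case: (ltgtP y z).
Qed.

(** With [s = (1 + t) / 2], a peak weighs [s ^ 2 * X], a valley 1 and any other letter [s]. Peaks
    and valleys alternate and the word ends in an ascent to 0, so there are as many valleys as peaks
    when [w] starts above [l]; otherwise there is one valley more, which costs the subtracted
    factor. *)
Lemma wt_peak X l w :
    t = ((1 + t) / 2) ^+ 2 * X -> uniq (l :: w) -> w <> [::] -> last 0 w < 0 ->
  wt R peak_wt l w 0
    = ((1 + t) / 2) ^+ (size w - (head 0 w < l)%R) * X ^+ peak (l :: w).
Proof.
move=> tE; elim: w l => [|y [|z w] IH] l // U _ h.
  have: l != y by apply: contraTneq U => -> /=; rewrite mem_head.
  rewrite /= in h *; rewrite /peak_wt /des_wt h /=.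
  by case: (ltgtP l y) => //= _ _; rewrite /peak /=; ring.
have ly : l != y by apply: contraTneq U => -> /=; rewrite mem_head.
have yz : y != z.
  by apply: contraTneq U => ->; rewrite !cons_uniq mem_head /= andbF.
have -> : wt R peak_wt l [:: y, z & w] 0
    = peak_wt y (l < y) (y < z) * wt R peak_wt y (z :: w) 0 by [].
rewrite IH //; last by case/andP: U.
rewrite peak_cons /peak_wt /des_wt /=.
case: (ltgtP l y) ly => // ly _; case: (ltgtP y z) yz => //= yz _.
- by rewrite add0n !subn0 mulrA -exprS.
- by rewrite (peak_cons_desc y z) // subn1 /= add1n !exprS {1}tE; ring.
- by rewrite mul1r subn0 subn1.
- by rewrite !subn1 /= mulrA -exprS.
Qed.
End Averaging.

(** * Posets with alternating labels *)

Definition maximalP {T : finType} (le : rel T) (x : T) : bool :=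
  [forall z, ~~ Defs.ltP le x z].

Section Poset.
Variables (T : finType) (le : rel T).
Hypothesis po : is_poset le.

Lemma ltP_trans : transitive (Defs.ltP le).
Proof.
case: po => _ anti tr y x z /andP[xy lxy] /andP[yz lyz].
rewrite /Defs.ltP (tr _ _ _ lxy lyz) andbT; apply: contraNneq xy => xz.
by apply/eqP/anti; rewrite lxy xz.
Qed.

Lemma ltP_irr x : Defs.ltP le x x = false.
Proof. by rewrite /Defs.ltP eqxx. Qed.

(** The number of elements below serves as a height for the extremal choices and inductions that
    follow. *)
Lemma card_below x y : Defs.ltP le x y ->
  (#|[set v | Defs.ltP le v x]| < #|[set v | Defs.ltP le v y]|)%N.
Proof.
move=> xy; apply: proper_card; apply/properP; split.
  by apply/subsetP => v; rewrite !inE => /ltP_trans; apply.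
by exists x; rewrite inE ?xy ?ltP_irr.
Qed.

Lemma cover_above x y : Defs.ltP le x y -> exists2 z, coverP le x z & le z y.
Proof.
case: (po) => refl _ tr xy.
pose P z := Defs.ltP le x z && le z y.
have yP : P y by rewrite /P xy refl.
case: (@arg_minnP T y P (fun z => #|[set v | Defs.ltP le v z]|) yP).
move=> z /andP[xz zy] zmin.
exists z => //; rewrite /coverP xz; apply/forallP => v; apply/negP => /andP[xv vz].
have := card_below v z vz; rewrite ltnNge zmin // /P xv /=.
by case/andP: vz => _ /tr; apply.
Qed.

Lemma cover_below x : ~~ minimalP le x -> exists z, coverP le z x.
Proof.
case/forallPn => z0; rewrite negbK => z0x.
case: (@arg_maxnP T z0 (fun z => Defs.ltP le z x)
         (fun z => #|[set v | Defs.ltP le v z]|) z0x) => z zx zmax.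
exists z; rewrite /coverP zx; apply/forallP => v; apply/negP => /andP[zv vx].
by have := card_below z v zv; rewrite ltnNge => /negP; apply; exact: zmax.
Qed.

Lemma saturated_chain x :
  exists x0 s, [/\ minimalP le x0, path (coverP le) x0 s & last x0 s = x].
Proof.
have [n] := ubnP #|[set v | Defs.ltP le v x]|; elim: n x => // n IH x lt_n.
have [xmin|/cover_below[z zx]] := boolP (minimalP le x); first by exists x, [::].
have zx' : Defs.ltP le z x by case/andP: zx.
have [|x0 [s [x0min ps lz]]] := IH z; first exact: leq_trans (card_below _ _ zx') _.
by exists x0, (rcons s x); rewrite rcons_path last_rcons lz ps.
Qed.

Lemma maximal_exists : (0 < #|T|)%N -> exists m, maximalP le m.
Proof.
case/card_gt0P => x0 _.
case: (@arg_maxnP T x0 predT (fun z => #|[set v | Defs.ltP le v z]|) isT) => m _ mmax.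
exists m; apply/forallP => v; apply/negP => /card_below; rewrite ltnNge.
by move/negP; apply; exact: mmax.
Qed.

(** A further element comparable with the whole chain would lie above [x0] by minimality, then above
    each next element by the cover relations, and so above the maximal last one. *)
Lemma saturated_max_chain x0 s :
    minimalP le x0 -> path (coverP le) x0 s -> maximalP le (last x0 s) ->
  max_chain le (x0 :: s).
Proof.
case: (po) => refl _ _ x0min ps smax; split.
  by apply: sub_path ps => x y /andP[].
move=> v; rewrite inE negb_or => /andP[vx0 vs] /= /andP[cx0 cs].
have x0v : Defs.ltP le x0 v.
  rewrite /Defs.ltP eq_sym vx0; case/orP: cx0 => // vx.
  by move/forallP: x0min => /(_ v); rewrite /Defs.ltP vx0 vx.
suff : Defs.ltP le (last x0 s) v by move/forallP: smax => /(_ v)/negbTE->.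
elim: s x0 ps vs cs x0v {x0min smax vx0 cx0} => //= y s IH x0.
move=> /andP[/andP[_ /forallP cov] ps]; rewrite inE negb_or => /andP[vy vs].
move=> /andP[cy cs] x0v; apply: IH => //.
rewrite /Defs.ltP eq_sym vy; case/orP: cy => // vly.
by have := cov v; rewrite x0v /Defs.ltP vy vly.
Qed.

End Poset.

(* Positive letters stand for elements of rank 1, negative ones for rank 0. *)
Record alternating {T : finType} (le : rel T) (om : T -> int) : Prop := Alternating {
  alt_cover : forall x y, coverP le x y -> (om x < 0) != (om y < 0);
  alt_min : forall x, minimalP le x -> om x < 0;
  alt_neq0 : forall x, om x != 0 }.
Arguments alt_cover {T le om}.
Arguments alt_min {T le om}.
Arguments alt_neq0 {T le om}.

Section Alternating.
Variables (T : finType) (le : rel T).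
Hypothesis po : is_poset le.

(** A cover of [x] weakly below [y] has the opposite sign, so it is not [y]. *)
Lemma alt_between om x y : alternating le om -> Defs.ltP le x y ->
    (om x < 0) = (om y < 0) ->
  exists z, [/\ Defs.ltP le x z, Defs.ltP le z y & (om z < 0) != (om x < 0)].
Proof.
move=> alt xy sxy; have [z cxz zy] := cover_above T le po x y xy.
have := alt_cover alt x z cxz => sz; exists z; rewrite eq_sym sz.
have xz : Defs.ltP le x z by case/andP: cxz.
split=> //; rewrite /Defs.ltP zy andbT; apply: contraNneq sz => ->.
by rewrite sxy.
Qed.

(** The chain does not involve the labels, so all alternating labelings of a poset have the same
    signs. *)
Lemma alt_parity om x0 s : alternating le om ->
    minimalP le x0 -> path (coverP le) x0 s ->
  (om (last x0 s) < 0) = ~~ odd (size s).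
Proof.
move=> alt x0min; elim/last_ind: s => [|s y IH] /=; first by rewrite (alt_min alt).
rewrite rcons_path last_rcons size_rcons /= => /andP[/IH <-].
by move/(alt_cover alt); case: (_ < 0); case: (_ < 0).
Qed.

Lemma chain_sum_rcons (om : T -> int) x0 s y :
  chain_sum om (x0 :: rcons s y) = chain_sum om (x0 :: s) + eps om (last x0 s) y.
Proof.
rewrite /chain_sum /=.
elim: s x0 => [|z s IH] x0 /=; first by rewrite big_cons !big_nil addrC.
by rewrite !big_cons IH addrA.
Qed.

Lemma canonical_chain_sum om x0 s :
    canonical_labeling le om -> minimalP le x0 -> path (coverP le) x0 s ->
  om (last x0 s) != 0 /\ chain_sum om (x0 :: s) = if om (last x0 s) < 0 then 0 else 1.
Proof.
case=> _ rho neg pos x0min ps.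
case: (rho (last x0 s)) => h; rewrite (h x0 s) //.
  by have := neg _ h; move: (om _) => v v0; rewrite v0 lt_eqF.
by have := pos _ h; move: (om _) => v v0; rewrite ltNge ltW // gt_eqF.
Qed.

(** A cover changes the chain sum by 1 or -1 while it stays in {0, 1}, so the sign toggles; a
    one-element chain has sum 0, so minimal elements are negative. *)
Lemma canonical_alternating om : canonical_labeling le om -> alternating le om.
Proof.
move=> can; split=> [x y cxy|x xmin|x].
- have [x0 [s [x0min ps lx]]] := saturated_chain T le po x.
  have [_] := canonical_chain_sum om x0 s can x0min ps.
  have [|_] := canonical_chain_sum om x0 (rcons s y) can x0min.
    by rewrite rcons_path ps lx.
  rewrite chain_sum_rcons last_rcons lx => + sE; rewrite sE /eps.
  by do 3!case: ifP.
- have [_] := canonical_chain_sum om x [::] can xmin isT.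
  by rewrite /chain_sum /= big_nil; case: ifP.
have [x0 [s [x0min ps lx]]] := saturated_chain T le po x.
by have [] := canonical_chain_sum om x0 s can x0min ps; rewrite lx.
Qed.

(** A saturated chain from a minimal element to [x] is a maximal chain, so its sum is the rank. *)
Lemma canonical_maximal om r x :
    canonical_labeling le om -> sign_graded_rank le om r -> maximalP le x ->
  r = if om x < 0 then 0 else 1.
Proof.
move=> can rk xmax; have [x0 [s [x0min ps lx]]] := saturated_chain T le po x.
have [_] := canonical_chain_sum om x0 s can x0min ps; rewrite lx => <-.
by apply/esym/rk/saturated_max_chain; rewrite ?lx.
Qed.

Lemma mem_JH (om : T -> int) w :
  (w \in JH le om) = perm_eq w (map om (enum T)) && linext le om w.
Proof. by rewrite mem_filter mem_permutations andbC. Qed.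

Lemma JH_uniq (om : T -> int) : uniq (JH le om).
Proof. by rewrite filter_uniq ?permutations_uniq. Qed.

(** * Words of the Jordan-Hölder set *)

Section Words.
Variable om : T -> int.
Hypothesis om_inj : injective om.

Lemma uniq_JH w : w \in JH le om -> uniq w.
Proof.
by rewrite mem_JH => /andP[/perm_uniq-> _]; rewrite map_inj_uniq ?enum_uniq.
Qed.

Lemma JH_mem w x : w \in JH le om -> om x \in w.
Proof.
by rewrite mem_JH => /andP[/perm_mem-> _]; rewrite map_f ?mem_enum.
Qed.

Lemma JH_memP w v : w \in JH le om -> v \in w -> exists x, v = om x.
Proof.
by rewrite mem_JH => /andP[/perm_mem-> _] /mapP[x _ ->]; exists x.
Qed.

Lemma size_JH w : w \in JH le om -> size w = #|T|.
Proof.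
by rewrite mem_JH => /andP[/perm_size-> _]; rewrite size_map -cardE.
Qed.

Lemma JH_lt w x y : w \in JH le om -> Defs.ltP le x y ->
  (index (om x) w < index (om y) w)%N.
Proof.
by rewrite mem_JH => /andP[_ /forallP/(_ x)/forallP/(_ y)/implyP]; apply.
Qed.

Lemma JH_head_minimal w : w \in JH le om -> (0 < #|T|)%N ->
  exists2 x, minimalP le x & head 0 w = om x.
Proof.
move=> wJ; rewrite -(size_JH w wJ); case: w wJ => // v w wJ _.
have [x vE] := JH_memP _ _ wJ (mem_head v w); exists x => //.
apply/forallP => z; apply/negP => /(JH_lt _ _ _ wJ).
by rewrite /= vE eqxx.
Qed.

Lemma JH_last_maximal w : w \in JH le om -> (0 < #|T|)%N ->
  exists2 x, maximalP le x & last 0 w = om x.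
Proof.
move=> wJ; rewrite -(size_JH w wJ); case/lastP: w wJ => // w v wJ _.
have [|x vE] := JH_memP _ v wJ; first by rewrite mem_rcons mem_head.
exists x; rewrite ?last_rcons //; rewrite {v}vE in wJ.
apply/forallP => z; apply/negP => /(JH_lt _ _ _ wJ).
have := JH_mem _ z wJ; rewrite -index_mem size_rcons ltnS => zw.
rewrite ltnNge; have := uniq_JH _ wJ; rewrite rcons_uniq => /andP[xw _].
by rewrite -{2}cats1 index_cat (negbTE xw) /= eqxx addn0 zw.
Qed.

(* Comparable elements of equal sign are separated by one of opposite sign, so
   a block of consecutive letters of equal sign is an antichain. *)
Lemma JH_block A B B' C (b : bool) : alternating le om ->
    A ++ B ++ C \in JH le om -> perm_eq B B' -> {in B, forall v, (v < 0) = b} ->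
  A ++ B' ++ C \in JH le om.
Proof.
move=> alt wJ BB' sB; have := wJ; rewrite !mem_JH => /andP[wE wl].
apply/andP; split.
  by apply: perm_trans wE; rewrite perm_cat2l perm_cat2r perm_sym.
apply/forallP => x; apply/forallP => y; apply/implyP => xy.
have := JH_lt _ _ _ wJ xy.
have sz := perm_size BB'.
have mB : B' =i B by move=> v; rewrite (perm_mem BB').
have iB v : v \in B -> (index v B' < size B)%N by rewrite sz index_mem mB.
have iB2 v : v \in B -> (index v B < size B)%N by rewrite index_mem.
have iA v : v \in A -> (index v A < size A)%N by rewrite index_mem.
(* Unless both labels lie in the block, permuting it does not affect which of them comes first. *)
have [/andP[xB yB]|] := boolP ((om x \in B) && (om y \in B)); last first.
  rewrite !index_cat !mB -sz => NB.
  move: (iA (om x)) (iA (om y)) (iB (om x)) (iB (om y)) (iB2 (om x)) (iB2 (om y)).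
  case: (om x \in A); case: (om y \in A); move: NB;
    case: (om x \in B); case: (om y \in B) => //= _;
    do 6![move=> /(_ isT) ? | move=> _]; lia.
have [|z [xz zy /eqP[]]] := alt_between om x y alt xy; first by rewrite !sB.
have wu := uniq_JH _ wJ.
suff zB : om z \in B by rewrite !sB.
have := JH_lt _ _ _ wJ xz; have := JH_lt _ _ _ wJ zy.
have [xA yA] : om x \notin A /\ om y \notin A.
  by move: wu; rewrite cat_uniq has_cat => /and3P[_ /norP[/hasPn h _] _];
    split; exact: h.
rewrite !index_cat (negbTE xA) (negbTE yA) xB yB.
move: (iB2 _ yB) (iA (om z)); case: (om z \in A); case: (om z \in B) => //=;
  move=> ?; [move=> /(_ isT) ? | move=> _]; lia.
Qed.

(** The move only permutes the block made of [om x] and its two runs, all of one sign. *)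
Lemma JH_hop w x : alternating le om -> w \in JH le om -> hop (om x) w \in JH le om.
Proof.
move=> alt wJ; have x0 := alt_neq0 alt x.
case: hopP (wJ) => [||L A B S /allP aA /allP aB _ _]; [exact: uniq_JH|exact: JH_mem|].
have E B1 B2 : B1 ++ om x :: B2 ++ S = (B1 ++ om x :: B2) ++ S by rewrite -catA.
rewrite !E => {}wJ; apply: (JH_block L (A ++ om x :: B) _ S (om x < 0)) => //.
  by apply/seq.permP => p; rewrite !count_cat /=; lia.
move=> v; rewrite mem_cat inE => /or3P[/aA|/eqP->//|/aB];
  rewrite /beyond; case: ifP; lia.
Qed.

(** The first letter labels a minimal element and the last a maximal one, so both are negative:
    bordering by 0 adds a descent in front and an ascent at the end, as in [wt_peak] with
    [l = 0]. *)
Lemma des_peak_rank0 (R : realFieldType) (t : R) :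
    alternating le om -> (forall x, maximalP le x -> om x < 0) -> (0 < #|T|)%N ->
    t != -1 ->
  Wdes le om t
    = ((1 + t) / 2) ^+ #|T|.-1 * Wpeak le om (4 * t / (1 + t) ^+ 2).
Proof.
move=> alt maxneg T0 t1; set X := 4 * t / _.
have tE : t = ((1 + t) / 2) ^+ 2 * X.
  by rewrite /X; field; rewrite addrC addr_eq0.
have lst w : w \in JH le om -> last 0 w < 0.
  by move=> wJ; have [x /maxneg ? ->] := JH_last_maximal w wJ T0.
have hd w : w \in JH le om -> head 0 w < 0.
  by move=> wJ; have [x /(alt_min alt) ? ->] := JH_head_minimal w wJ T0.
transitivity (\sum_(w <- JH le om) wt R (des_wt R t) 0 w 0).
  by apply: eq_big_seq => w wJ; rewrite wt_des ?(uniq_JH _ wJ) ?lst.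
have n0 : 0 \notin map om (enum T).
  by apply/mapP => -[x _ /eqP]; rewrite eq_sym (negbTE (alt_neq0 alt x)).
rewrite (sum_mixed_wt _ _ _ (map om (enum T))) //; first last.
- by move=> _ w /mapP[x _ ->] wJ; apply: JH_hop.
- by move=> w wJ _ /mapP[x _ ->]; apply: JH_mem.
- by move=> w /uniq_JH.
- by rewrite map_inj_uniq ?enum_uniq.
- exact: JH_uniq.
rewrite /Wpeak mulr_sumr; apply: eq_big_seq => w wJ.
have wE : perm_eq w (map om (enum T)) by move: wJ; rewrite mem_JH => /andP[].
rewrite (eq_wt _ _ (peak_wt R t)); last first.
  by move=> y yw b c; rewrite /mixed_wt -(perm_mem wE) yw.
rewrite (wt_peak _ _ X) // ?lst //; first last.
- by move=> w0; have := size_JH _ wJ; rewrite w0 /= => E; rewrite -E in T0.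
- by rewrite cons_uniq (perm_mem wE) n0 (uniq_JH _ wJ).
(* The descent from 0 to the first letter lowers the exponent by one and creates no peak. *)
rewrite hd // subn1 (size_JH _ wJ).
by case: w wJ {wE} => [|a w] wJ; rewrite ?peak_cons_desc //; exact: (hd _ wJ).
Qed.
End Words.
End Alternating.

Arguments JH_mem {T le om w} x.
Arguments JH_memP {T le om w v}.
Arguments uniq_JH {T le om} om_inj {w}.
Arguments JH_lt {T le om w x y}.
Arguments size_JH {T le om w}.

(** * Independence of the labeling *)

Lemma index_map_in (T U : eqType) (f : T -> U) x s :
  {in x :: s &, injective f} -> index (f x) (map f s) = index x s.
Proof.
elim: s => //= y s IH finj; rewrite IH; last first.
  by apply: sub_in2 finj => z; rewrite !inE => /orP[]->; rewrite ?orbT.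
by rewrite (inj_in_eq finj) ?inE ?eqxx ?orbT.
Qed.

Section Relabel.
Variables (T : finType) (le : rel T).

Lemma JH_map (o1 o2 : T -> int) f w : injective o2 ->
  (forall x, f (o1 x) = o2 x) -> w \in JH le o1 -> map f w \in JH le o2.
Proof.
move=> o2inj fE wJ.
have finj : {in w &, injective f}.
  move=> u v uw vw.
  have [x ->] := JH_memP wJ uw; have [y ->] := JH_memP wJ vw.
  by rewrite !fE => /o2inj->.
have iE x : index (o2 x) (map f w) = index (o1 x) w.
  rewrite -fE index_map_in //; apply: sub_in2 finj => u; rewrite inE.
  by case/orP => // /eqP->; exact: JH_mem wJ.
rewrite mem_JH; apply/andP; split.
  move: wJ; rewrite mem_JH => /andP[/(perm_map f)/perm_trans+ _]; apply.
  by rewrite -map_comp (eq_map fE).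
apply/forallP => x; apply/forallP => y; apply/implyP; rewrite !iE.
exact: JH_lt wJ.
Qed.

Lemma sum_JH_map (V : nmodType) (o1 o2 : T -> int) f (F : seq int -> V) :
    injective o1 -> injective o2 -> (forall x, f (o1 x) = o2 x) ->
  \sum_(w <- JH le o2) F w = \sum_(w <- JH le o1) F (map f w).
Proof.
move=> o1inj o2inj fE.
(* [g] inverts [f] on the labels; the value 0 elsewhere is arbitrary. *)
pose g v := if [pick x | o2 x == v] is Some x then o1 x else 0.
have gE x : g (o2 x) = o1 x.
  rewrite /g; case: pickP => [y /eqP/o2inj->//|/(_ x)]; by rewrite eqxx.
have fK : {in JH le o1, cancel (map f) (map g)}.
  move=> w wJ; rewrite -map_comp -[RHS]map_id; apply/eq_in_map => v vw /=.
  by have [x ->] := JH_memP wJ vw; rewrite fE gE.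
have gK : {in JH le o2, cancel (map g) (map f)}.
  move=> w wJ; rewrite -map_comp -[RHS]map_id; apply/eq_in_map => v vw /=.
  by have [x ->] := JH_memP wJ vw; rewrite gE fE.
rewrite -(big_map (map f) predT F); apply: perm_big; apply: uniq_perm => [||w].
- exact: JH_uniq.
- by rewrite map_inj_in_uniq ?JH_uniq //; exact: can_in_inj fK.
apply/idP/mapP => [wJ|[w' wJ ->]]; last exact: JH_map wJ.
by exists (map g w); rewrite ?gK //; exact: JH_map wJ.
Qed.

Definition transp (i j v : int) : int := if v == i then j else if v == j then i else v.

(** [sorted (apart i j) w] expresses that [i] and [j] are not neighbours in [w]. *)
Definition apart (i j : int) : rel int :=
  fun a b => ~~ (((a == i) && (b == j)) || ((a == j) && (b == i))).

Lemma transpK i j : involutive (transp i j).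
Proof.
by move=> v; rewrite /transp; do 4?case: eqP => //; move=> *; subst.
Qed.

Lemma apart_transp i j a b : apart i j (transp i j a) (transp i j b) = apart i j a b.
Proof. by rewrite /apart /transp; do 4?[case: ifP => ?]; lia. Qed.

Lemma unsortedP (U : eqType) (e : rel U) s : ~~ sorted e s ->
  exists A a b C, s = A ++ [:: a; b] ++ C /\ ~~ e a b.
Proof.
elim: s => // a [|b s] IH //=; have [_|nab _] := boolP (e a b); last first.
  by exists [::], a, b, s.
by move=> /= /IH[A [c [d [C [-> cd]]]]]; exists (a :: A), c, d, C.
Qed.

(** No letter lies strictly between [i] and [j], so the transposition reverses no comparison except
    that of [i] with [j]. *)
Lemma des_transp i j w : i < j -> {in w, forall v, ~~ (i < v < j)} ->
  sorted (apart i j) w -> des (map (transp i j) w) = des w.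
Proof.
move=> ij; elim: w => // a [|b w] IH // nb /= /andP[ab sw].
rewrite !des_cons -[_ :: _]/(map (transp i j) (b :: w)) IH //; last first.
  by move=> v vw; apply: nb; rewrite inE vw orbT.
congr (_ + _)%N; move: ab (nb a) (nb b).
rewrite !inE !eqxx orbT => + /(_ isT) + /(_ isT).
by rewrite /apart /transp => ? ? ?; congr nat_of_bool; do 4?[case: ifP => ?]; lia.
Qed.

(* Words in which x and y are neighbours are paired by exchanging x and y; in
   the others no comparison of neighbours is affected. *)
Lemma Wdes_tperm (R : realFieldType) (t : R) (o : T -> int) x y :
    is_poset le -> injective o -> alternating le o ->
    (o x < 0) = (o y < 0) -> o x < o y -> (forall z, ~~ (o x < o z < o y)) ->
  Wdes le (o \o tperm x y) t = Wdes le o t.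
Proof.
move=> po oinj alt sxy xy nb; pose s := transp (o x) (o y).
rewrite /Wdes (sum_JH_map _ o _ s) //; first last.
- move=> z; rewrite /s /transp /=.
  case: tpermP => [->|->|/eqP zx /eqP zy]; rewrite ?eqxx ?(inj_eq oinj) //.
    by case: eqP => // ->.
  by rewrite (negbTE zx) (negbTE zy).
- by apply: inj_comp => //; exact: perm_inj.
pose ap := sorted (apart (o x) (o y)).
(* When the two labels are apart, [map s w] may leave the Jordan-Hölder set but has as many descents
   as [w], so [w] stands in for it. *)
pose h w := if ap w then w else map s w.
have hap w : ap (map s w) = ap w.
  by rewrite /ap sorted_map; apply: eq_sorted => a b; exact: apart_transp.
transitivity (\sum_(w <- JH le o) t ^+ des (h w)).
  apply: eq_big_seq => w wJ; rewrite /h; case: ifP => // apw.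
  by rewrite des_transp // => v /(JH_memP wJ)[z ->].
apply: (big_involutive _ _ _ h (fun w => t ^+ des w)); first exact: JH_uniq.
  move=> w wJ; rewrite /h; case: ifP => // /negbT/unsortedP[A [a [b [C [wE ab]]]]].
  have wu := uniq_JH oinj wJ.
  have sid v : v \in A ++ C -> s v = v.
    move=> vAC; have: v \notin [:: a; b].
      move: wu; rewrite wE (uniq_catCA A) cat_uniq => /and3P[_ /hasPn/(_ v vAC)//].
    move: ab; rewrite negbK !inE /s /transp.
    by case/orP => /andP[/eqP-> /eqP->]; do 2?case: eqP.
  have -> : map s w = A ++ [:: b; a] ++ C.
    rewrite wE !map_cat; congr (_ ++ _ ++ _).
    - by rewrite -[RHS]map_id; apply/eq_in_map => v vA; rewrite sid // mem_cat vA.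
    - move: ab; rewrite negbK /s /transp /=.
      case/orP => /andP[/eqP-> /eqP->]; rewrite !eqxx; first by case: eqP => // ->.
      by case: eqP => // ->.
    - by rewrite -[RHS]map_id; apply/eq_in_map => v vA; rewrite sid // mem_cat vA orbT.
  rewrite wE in wJ; apply: (JH_block _ _ po _ oinj _ _ _ _ (o x < 0) alt wJ).
    by rewrite (perm_catC [:: a] [:: b]).
  move=> v; rewrite !inE; move: ab; rewrite negbK.
  by case/orP => /andP[/eqP-> /eqP->] /orP[]/eqP->.
move=> w wJ; rewrite /h; case: (boolP (ap w)) => [->//|]; rewrite hap => /negbTE->.
exact/mapK/transpK.
Qed.

(** Induction on the number of inversions, the pairs that the two labelings order oppositely:
    transposing the inverted pair with the closest labels removes at least one and creates none. *)
Lemma Wdes_relabel (R : realFieldType) (t : R) (o1 o2 : T -> int) :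
    is_poset le -> injective o1 -> injective o2 -> alternating le o1 ->
    (forall x, (o1 x < 0) = (o2 x < 0)) ->
  Wdes le o1 t = Wdes le o2 t.
Proof.
move=> po.
pose inv (o : T -> int) := [set p : T * T | (o p.1 < o p.2) && (o2 p.2 < o2 p.1)].
have [n] := ubnP #|inv o1|; elim: n o1 => // n IH o1 lt_n i1 i2 alt ss.
have [/set0Pn[p0 p0i]|] := boolP (inv o1 != set0); last first.
  (* Without inversions both labelings order the elements alike, and translating the words preserves
     descents. *)
  rewrite negbK => /eqP i0.
  pose f v := if [pick x | o1 x == v] is Some x then o2 x else 0.
  have fE x : f (o1 x) = o2 x.
    rewrite /f; case: pickP => [y /eqP/i1->//|/(_ x)]; by rewrite eqxx.
  have lt12 x y : (o2 x < o2 y) = (o1 x < o1 y).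
    have n1 u v : o1 u < o1 v -> o2 v < o2 u -> False.
      move=> h1 h2; have: (u, v) \in inv o1 by rewrite inE h1.
      by rewrite i0 inE.
    case: (ltgtP (o1 x) (o1 y)) => [h|h|/i1->]; rewrite ?ltxx //.
      case: (ltgtP (o2 x) (o2 y)) => // [/(n1 _ _ h)//|/i2 xy].
      by rewrite xy ltxx in h.
    by apply/negbTE/negP => /(n1 _ _ h).
  rewrite [RHS]/Wdes (sum_JH_map _ o1 _ f) //; apply: eq_big_seq => w wJ.
  congr (_ ^+ _); have: {subset w <= map o1 (enum T)}.
    by move: wJ; rewrite mem_JH => /andP[/perm_mem h _] v; rewrite h.
  elim: w {wJ} => // a [|b w] IHw // sub; rewrite /= !des_cons.
  rewrite -[_ :: map f w]/(map f (b :: w)) -IHw; last first.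
    by move=> v vw; apply: sub; rewrite inE vw orbT.
  have /mapP[u _ ->] := sub a (mem_head _ _).
  have /mapP[v _ ->] : b \in map o1 (enum T) by apply: sub; rewrite !inE eqxx orbT.
  by rewrite !fE lt12.
case: (@arg_minnP _ p0 (fun p => p \in inv o1)
         (fun p => `|o1 p.2 - o1 p.1|%N) p0i) => [[x y]].
rewrite inE /= => /andP[xy yx] pmin.
(* A label strictly between would form, with one of the two, an inversion with closer labels. *)
have nb z : ~~ (o1 x < o1 z < o1 y).
  apply/negP => /andP[xz zy]; have := ltgtP (o2 x) (o2 z); case=> [h|h|/i2 E].
  - have /pmin /= : (z, y) \in inv o1 by rewrite inE /= zy (lt_trans yx).
    lia.
  - have /pmin /= : (x, z) \in inv o1 by rewrite inE /= xz.
    lia.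
  - by rewrite E ltxx in xz.
(* An inverted pair cannot straddle 0, as the signs agree in both labelings. *)
have sxy : (o1 x < 0) = (o1 y < 0) by move: (ss x) (ss y); lia.
rewrite -(Wdes_tperm _ _ o1 x y) //.
have sE z : ((o1 \o tperm x y) z < 0) = (o1 z < 0).
  by rewrite /=; case: tpermP => // ->.
apply: IH => //.
- have: inv (o1 \o tperm x y) \proper inv o1.
    apply/properP; split; last first.
      by exists (x, y); rewrite !inE /= ?xy ?yx // tpermL tpermR andbT -leNgt ltW.
    apply/subsetP => -[u v]; rewrite !inE /= => /andP[+ vu]; rewrite vu andbT.
    move: vu (nb u) (nb v) xy yx.
    case: tpermP => [->|->|/eqP + /eqP +]; case: tpermP => [->|->|/eqP + /eqP +];
      rewrite -?(inj_eq i1); lia.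
  by move/proper_card => lt_i; apply: leq_trans lt_i _.
- by apply: inj_comp => //; exact: perm_inj.
- split=> [u v|u|u]; rewrite ?sE; [exact: (alt_cover alt)|exact: (alt_min alt)|].
  exact: (alt_neq0 alt).
- by move=> z; rewrite sE ss.
Qed.
End Relabel.

(** * Adjoining a greatest element, and the coefficients *)

Section Hat.
Variables (T : finType) (le : rel T).
Hypothesis po : is_poset le.

Lemma hat_poset : is_poset (hat_le le).
Proof.
case: po => refl anti tr; split.
- by case=> [x|] //=.
- by case=> [x|] [y|] //= /anti->.
- by case=> [y|] [x|] [z|] //=; exact: tr.
Qed.

Lemma hat_lt x y : Defs.ltP (hat_le le) (Some x) (Some y) = Defs.ltP le x y.
Proof. by []. Qed.

Lemma hat_cover x y : coverP (hat_le le) (Some x) (Some y) = coverP le x y.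
Proof.
rewrite /coverP hat_lt; congr (_ && _); apply/forallP/forallP => h z.
  exact: (h (Some z)).
by case: z => [z|]; rewrite ?hat_lt // /Defs.ltP /= andbF.
Qed.

Lemma hat_minimal x : minimalP (hat_le le) (Some x) = minimalP le x.
Proof.
apply/forallP/forallP => h z; first exact: (h (Some z)).
by case: z => [z|]; rewrite ?hat_lt.
Qed.

Lemma hat_maximal y : maximalP (hat_le le) y -> y = None.
Proof. by case: y => // x /forallP/(_ None). Qed.

Lemma hat_cover_top m : maximalP le m -> coverP (hat_le le) (Some m) None.
Proof.
move=> /forallP mmax; rewrite /coverP /=; apply/forallP => -[z|] //.
by rewrite hat_lt (negbTE (mmax z)).
Qed.

Lemma hat_alternating omh :
  alternating (hat_le le) omh -> alternating le (omh \o Some).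
Proof.
move=> alt; split=> [x y|x|x] /=.
- by rewrite -hat_cover => /(alt_cover alt).
- by rewrite -hat_minimal => /(alt_min alt).
- exact: alt_neq0 alt _.
Qed.

Lemma perm_enum_option : perm_eq (enum {: option T}) (None :: map Some (enum T)).
Proof.
apply: uniq_perm => [||[x|]]; first exact: enum_uniq.
- rewrite /= map_inj_uniq ?enum_uniq ?andbT; last by move=> x y [].
  by apply/mapP => -[].
- by rewrite mem_enum in_cons (map_f Some) ?mem_enum ?orbT.
- by rewrite mem_enum in_cons.
Qed.

Section HatWords.
Variable omh : option T -> int.
Hypothesis omh_inj : injective omh.

Lemma rcons_JH_hat w :
  (rcons w (omh None) \in JH (hat_le le) omh) = (w \in JH le (omh \o Some)).
Proof.
rewrite !mem_JH.
have -> : perm_eq (rcons w (omh None)) (map omh (enum {: option T}))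
    = perm_eq w (map (omh \o Some) (enum T)).
  rewrite perm_rcons (permPr (perm_map omh perm_enum_option)) /= perm_cons.
  by rewrite -map_comp.
have [wE|//] := boolP (perm_eq w _).
have wS x : omh (Some x) \in w by rewrite (perm_mem wE) (map_f (omh \o Some)) ?mem_enum.
have wN : omh None \notin w.
  by rewrite (perm_mem wE); apply/mapP => -[x _ /omh_inj].
have iS x : index (omh (Some x)) (rcons w (omh None)) = index (omh (Some x)) w.
  by rewrite -cats1 index_cat wS.
have iN : index (omh None) (rcons w (omh None)) = size w.
  by rewrite -cats1 index_cat (negbTE wN) /= eqxx addn0.
apply/forallP/forallP => h x.
  apply/forallP => y; have /forallP/(_ (Some y)) := h (Some x).
  by rewrite hat_lt !iS.
case: x => [x|]; apply/forallP => -[y|] //.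
- by rewrite hat_lt !iS; have /forallP/(_ y) := h x.
- by rewrite iS iN index_mem wS implybT.
Qed.

(** The last letter labels a maximal element, and the top is the only one. *)
Lemma sum_JH_hat (V : nmodType) (F : seq int -> V) :
  \sum_(w <- JH (hat_le le) omh) F w
    = \sum_(w <- JH le (omh \o Some)) F (rcons w (omh None)).
Proof.
rewrite -(big_map (rcons^~ (omh None)) predT F); apply: perm_big.
apply: uniq_perm => [||w]; first exact: JH_uniq.
  by rewrite map_inj_uniq ?JH_uniq //; exact: rcons_injl.
apply/idP/mapP => [wJ|[w' wJ ->]]; last by rewrite rcons_JH_hat.
have [|_ /hat_maximal-> lE] := JH_last_maximal _ _ _ omh_inj _ wJ.
  by apply/card_gt0P; exists None.
case/lastP: w wJ lE => [|w v] wJ lE.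
  by have := JH_mem None wJ.
by rewrite last_rcons in lE; rewrite lE rcons_JH_hat in wJ *; exists w.
Qed.
End HatWords.

(** The top covers a maximal, hence positive, element of [T], so it is negative and the rank 0
    formula applies to the enlarged poset. There its label ends every word after a positive letter:
    one more descent, whence the factor [t]. By [alt_parity], [om] and the restriction of [omh] have
    the same signs, so [Wdes_relabel] exchanges them. *)
Lemma des_peak_rank1 (R : realFieldType) (t : R) om omh :
    injective om -> injective omh -> alternating le om ->
    alternating (hat_le le) omh -> (forall x, maximalP le x -> 0 < om x) ->
    (0 < #|T|)%N -> t != -1 ->
  t * Wdes le om t
    = ((1 + t) / 2) ^+ #|T| * Wpeak (hat_le le) omh (4 * t / (1 + t) ^+ 2).
Proof.
move=> oinj hinj alt hatalt maxpos T0 t1.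
have altS := hat_alternating _ hatalt.
have Sinj : injective (omh \o Some) by apply: inj_comp => // x y [].
have ss x : (om x < 0) = ((omh \o Some) x < 0).
  have [x0 [s [x0min ps <-]]] := saturated_chain T le po x.
  by rewrite (alt_parity T le om) // (alt_parity T le (omh \o Some)).
have topneg : omh None < 0.
  have [m mmax] := maximal_exists T le po T0.
  have := alt_cover hatalt _ _ (hat_cover_top m mmax).
  by have := ss m; rewrite /= => <-; have := maxpos m mmax; lia.
have := des_peak_rank0 _ _ hat_poset _ hinj R t hatalt.
rewrite card_option /= => <- //; first last.
  by move=> y /hat_maximal->.
rewrite (Wdes_relabel _ _ _ _ _ (omh \o Some)) // /Wdes sum_JH_hat // mulr_sumr.
apply: eq_big_seq => w wJ; rewrite -exprS; congr (_ ^+ _).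
have [x xmax lE] := JH_last_maximal _ _ _ Sinj _ wJ T0.
case: w wJ lE => [|a w] wJ lE; first by have := size_JH wJ => E; rewrite -E in T0.
rewrite des_rcons; rewrite /= in lE; rewrite lE.
by have := ss x; have := maxpos x xmax; rewrite /=; lia.
Qed.

End Hat.

(** * Comparison of coefficients *)

Lemma sum_exp_count (R : nzRingType) (I : Type) (s : seq I) (f : I -> nat) (x : R) m :
    all (fun i => f i < m)%N s ->
  \sum_(i <- s) x ^+ f i = \sum_(j < m) (count (fun i => f i == j) s)%:R * x ^+ j.
Proof.
elim: s => [|i s IH] /=; first by rewrite big_nil big1 // => j _; rewrite mul0r.
case/andP => fi /IH; rewrite big_cons => ->.
under [RHS]eq_bigr do rewrite natrD mulrDl.
rewrite big_split /=; congr (_ + _).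
rewrite (bigD1 (Ordinal fi)) //= eqxx mul1r big1 ?addr0 //.
move=> j /negbTE ji; case: eqP => [E|_]; last by rewrite mul0r.
by move: ji; rewrite -val_eqE /= E eqxx.
Qed.

(** Testing at natural numbers avoids the excluded point [-1]. *)
Lemma poly_nat_roots (R : realFieldType) (p : {poly R}) :
  (forall n : nat, p.[n%:R] = 0) -> p = 0.
Proof.
move=> p0; apply/eqP; apply: contraT => pn0.
have := max_poly_roots pn0 (rs := [seq n%:R | n <- iota 0 (size p)]).
rewrite size_map size_iota ltnn; apply.
- by apply/allP => _ /mapP[n _ ->]; apply/rootP.
- by rewrite map_inj_uniq ?iota_uniq //; exact: mulrIn (oner_neq0 R).
Qed.

(* The terms have pairwise distinct lowest degrees. *)
Lemma gamma_unique (R : realFieldType) m (e : nat -> nat) (a b : nat -> R) :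
    (forall n : nat, let t : R := n%:R in
      \sum_(i < m) a i * t ^+ i * (1 + t) ^+ e i
        = \sum_(i < m) b i * t ^+ i * (1 + t) ^+ e i) ->
  forall i, (i < m)%N -> a i = b i.
Proof.
move=> ab.
pose Q := \sum_(i < m) (a i - b i) *: ('X^i * (1 + 'X) ^+ e i : {poly R}).
have Q0 : Q = 0.
  apply: poly_nat_roots => n; rewrite /Q horner_sum.
  transitivity (\sum_(i < m) a i * n%:R ^+ i * (1 + n%:R) ^+ e i
      - \sum_(i < m) b i * n%:R ^+ i * (1 + n%:R : R) ^+ e i).
    rewrite -sumrB; apply: eq_bigr => i _.
    by rewrite !hornerE /= -!mulrBl.
  by rewrite ab subrr.
move=> i; have [n] := ubnP i; elim: n i => // n IH i lt_in im.
apply/eqP; rewrite -subr_eq0.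
have := congr1 (fun p : {poly R} => p`_i) Q0; rewrite coef0 => <-; apply/eqP/esym.
(* A power of [1 + 'X] has constant term 1; terms of larger index have no coefficient at [i], and
   those of smaller index vanish by induction. *)
rewrite coef_sum (bigD1 (Ordinal im)) //= coefZ coefXnM ltnn subnn.
rewrite -horner_coef0 !hornerE expr1n mulr1 big1 ?addr0 // => j.
rewrite -val_eqE /= coefZ coefXnM => ji; case: ltnP => [_|ij]; first by rewrite mulr0.
by rewrite IH ?subrr ?mul0r ?ltn_ord //; lia.
Qed.

(** As [2 * j <= q], the power of [1 + t] in front absorbs the denominators, and the truncated
    subtraction is exact. *)
Lemma gamma_expand (R : realFieldType) (t : R) q (c : nat -> R) : t != -1 ->
  ((1 + t) / 2) ^+ q * (\sum_(j < q./2.+1) c j * (4 * t / (1 + t) ^+ 2) ^+ j)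
  = \sum_(j < q./2.+1) (2 ^- q * 4 ^+ j * c j) * t ^+ j * (1 + t) ^+ (q - 2 * j).
Proof.
move=> t1; rewrite mulr_sumr; apply: eq_bigr => j _.
have t0 : 1 + t != 0 by rewrite addrC addr_eq0.
have qE : q = (q - 2 * j + 2 * j)%N by have := ltn_ord j; lia.
have -> : ((1 + t) / 2) ^+ q = 2 ^- q * ((1 + t) ^+ (q - 2 * j) * ((1 + t) ^+ 2) ^+ j).
  by rewrite -exprM -exprD -qE expr_div_n mulrC.
have : ((1 + t) ^+ 2) ^+ j != 0 by rewrite !expf_neq0.
rewrite expr_div_n [(4 * t) ^+ j]exprMn.
move: (((1 + t) ^+ 2) ^+ j) ((1 + t) ^+ (q - _)).
by move: (_ ^- q) (4 ^+ j) (t ^+ j) => *; field.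
Qed.

Lemma exprz_gamma (R : realFieldType) (q i : nat) :
  2 ^- q * 4 ^+ i = (2 : R) ^ (- q%:Z + 2 * i%:Z).
Proof.
have two0 : (2 : R) != 0 by rewrite pnatr_eq0.
rewrite expfzDr // exprnN -[_ ^ (2 * _)%R]/(2 ^+ (2 * i)) exprM.
by congr (_ * _ ^+ _); ring.
Qed.

Lemma Wpeak_count (R : realFieldType) (T : finType) (le : rel T) om (x : R) :
  (0 < #|T|)%N ->
  Wpeak le om x = \sum_(j < (#|T|.-1)./2.+1)
    (count (fun w => peak w == j) (JH le om))%:R * x ^+ j.
Proof.
move=> T0; apply: sum_exp_count; apply/allP => w wJ.
by have := peak_bound w; rewrite (size_JH wJ); lia.
Qed.

Theorem theorem6p4 (R : realFieldType) (T : finType) (le : rel T) (om : T -> int)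
    (r : int) :
  is_poset le -> injective om -> (0 < #|T|)%N ->
  canonical_labeling le om -> sign_graded_rank le om r ->
  let p := #|T| in
  (r = 0 ->
     (forall t : R, t != -1 ->
        Wdes le om t =
        2 ^- p.-1 * (1 + t) ^+ p.-1 * Wpeak le om (4 * t / (1 + t) ^+ 2))
     /\
     (forall a : nat -> R,
        (forall t : R, Wdes le om t =
           \sum_(i < (p.-1)./2.+1) a i * t ^+ i * (1 + t) ^+ (p.-1 - 2 * i)) ->
        forall i : nat, (i <= (p.-1)./2)%N ->
          a i = (2 : R) ^ (- (p%:Z) + 1 + 2 * i%:Z) *
                (count (fun w => peak w == i) (JH le om))%:R))
  /\
  (r = 1 ->
     forall omh : option T -> int,
       injective omh -> canonical_labeling (hat_le le) omh ->
       (forall t : R, t != 0 -> t != -1 ->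
          Wdes le om t =
          2 ^- p * t^-1 * (1 + t) ^+ p * Wpeak (hat_le le) omh (4 * t / (1 + t) ^+ 2))
       /\
       (forall a : nat -> R,
          (forall t : R, Wdes le om t =
             \sum_(i < (p - 2)./2.+1) a i * t ^+ i * (1 + t) ^+ (p - 2 - 2 * i)) ->
          forall i : nat, (i <= (p - 2)./2)%N ->
            a i = (2 : R) ^ (- (p%:Z) + 2 + 2 * i%:Z) *
                  (count (fun w => peak w == i.+1) (JH (hat_le le) omh))%:R)).
Proof.
move=> po oinj T0 can rk p.
have alt := canonical_alternating T le po om can.
have rE x := canonical_maximal T le po om r x can rk.
split=> [r0|r1 omh hinj hcan].
  have maxneg x : maximalP le x -> om x < 0 by move/rE; rewrite r0; case: ifP.
  have main t := des_peak_rank0 T le po om oinj R t alt maxneg T0.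
  split=> [t t1|a aE i ip]; first by rewrite main // expr_div_n [X in X * _ = _]mulrC.
  have -> : - p%:Z + 1 + 2 * i%:Z = - (p.-1)%:Z + 2 * i%:Z by lia.
  pose c j : R := (count (fun w => peak w == j) (JH le om))%:R.
  rewrite -exprz_gamma -/(c i).
  apply: (gamma_unique R (p.-1)./2.+1 (fun i => (p.-1 - 2 * i)%N) a
            (fun i => 2 ^- p.-1 * 4 ^+ i * c i) _ i ip) => n t.
  have t1 : t != -1 by rewrite -subr_eq0; have := ler0n R n; rewrite /t; lra.
  by rewrite -aE main // Wpeak_count // (gamma_expand _ _ _ c).
have maxpos x : maximalP le x -> 0 < om x.
  by move/rE; rewrite r1; have := alt_neq0 alt x; case: ltgtP.
have hatalt := canonical_alternating _ _ (hat_poset T le po) _ hcan.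
have main t := des_peak_rank1 T le po R t om omh oinj hinj alt hatalt maxpos T0.
split=> [t t0 t1|a aE i ip].
  apply: (mulfI t0); rewrite main // expr_div_n.
  by rewrite -/p; field; rewrite t0 expf_neq0 // pnatr_eq0.
(* A maximal element is positive and a minimal one negative, so they differ; this makes [p - 2] an
   exact subtraction. *)
have p2 : (1 < p)%N.
  have [m mmax] := maximal_exists T le po T0.
  have [x0 [s [x0min _ _]]] := saturated_chain T le po m.
  rewrite ltnNge; apply/negP => /card_le1P /(_ m isT) /(_ x0).
  rewrite !inE => /esym/eqP E.
  by have := maxpos m mmax; have := alt_min alt x0 x0min; rewrite E; lia.
have -> : - p%:Z + 2 + 2 * i%:Z = - p%:Z + 2 * i.+1%:Z by lia.
pose c j : R := (count (fun w => peak w == j) (JH (hat_le le) omh))%:R.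
rewrite -exprz_gamma -/(c i.+1).
have ip' : (i.+1 < p./2.+1)%N by lia.
(* Multiplying by [t] shifts the coefficients by one and puts 0 in front, so [a i] matches [i.+1]
   peaks. *)
apply: (gamma_unique R p./2.+1 (fun i => (p - 2 * i)%N)
          (fun j => if j is j'.+1 then a j' else 0)
          (fun i => 2 ^- p * 4 ^+ i * c i) _ i.+1 ip') => n t.
have t1 : t != -1 by rewrite -subr_eq0; have := ler0n R n; rewrite /t; lra.
transitivity (t * Wdes le om t).
  rewrite aE big_ord_recl !mul0r add0r mulr_sumr.
  have -> : p./2 = (p - 2)./2.+1 by lia.
  apply: eq_bigr => j _; rewrite /= /bump /= add1n exprS.
  have -> : (p - 2 * j.+1 = p - 2 - 2 * j)%N by lia.
  ring.
by rewrite main // Wpeak_count ?card_option //= (gamma_expand _ _ _ c).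
Qed.
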